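(* Let $A$ be a finite alphabet, let $R\subseteq A^*\times A^*$ be a finite set, and let $R^{\#}$ be the least two-sided congruence on $A^*$ containing $R$. Then the following hold: (a) If a congruence enumeration for $R^{\#}$ terminates with output word graph $\Gamma=(N,E)$, then $A^*/R^{\#}$ is finite and the function $\phi:N\times A^*\to N$ defined by $(\alpha,w)\phi=\beta$ whenever $w$ labels an $(\alpha,\beta)$-path in $\Gamma$ is a right action that is isomorphic to the (faithful) natural action of $A^*/R^{\#}$ on itself by right multiplication. (b) If $A^*/R^{\#}$ is finite, then any congruence enumeration for $R^{\#}$ terminates.
   Context: **Words and actions.** The alphabet $A$ is assumed to be totally ordered. $A^*$ is the free monoid on $A$, with empty word $\varepsilon$; $\mathfrak{P}(X)$ is the power set of $X$; $\Delta_X$ is the equality relation on $X$. Functions are written on the right of their arguments. A right action of a monoid $T$ on a set $X$ is a function $\Psi:X\times T\to X$ with $((x,s)\Psi,t)\Psi=(x,st)\Psi$ and $(x,1)\Psi=x$; write $x\cdot s$ for $(x,s)\Psi$. Its kernel is $\{(s,t)\in T\times T: x\cdot s=x\cdot t\text{ for all }x\in X\}$; it is faithful if its kernel is equality. An isomorphism of right actions of $T$ on $X$ and $Y$ is a bijection $\lambda:X\to Y$ with $(x\cdot s)\lambda=(x)\lambda\cdot s$ for all $x\in X$, $s\in T$. If $\mu$ is a congruence on $T$ contained in the kernel of an action of $T$ on $X$, that action is also regarded as isomorphic to the induced action $x\cdot(s/\mu)=x\cdot s$ of $T/\mu$ on $X$; it is in this sense that the action $\phi$ of $A^*$ is isomorphic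 to an action of $A^*/R^{\#}$. **Word graphs.** A word graph (over $A$) is a digraph $\Gamma=(N,E)$ with $N\subseteq\mathbb{N}=\{0,1,2,\ldots\}$ a finite set of nodes, $0\in N$, and $E\subseteq N\times A\times N$ a set of edges; $(\alpha,a,\beta)\in E$ has source $\alpha$, label $a$, target $\beta$. An $(\alpha,\beta)$-path is a (possibly empty) sequence of consecutive edges from $\alpha$ to $\beta$; its source is $\alpha$, its target is $\beta$, and it is labelled by the word of its edge labels. The path relation $\pi_\Gamma:N\to\mathfrak{P}(A^*\times A^* )$ is defined by: $(u,v)\in(\alpha)\pi_\Gamma$ iff there is a node $\beta$ such that $u$ and $v$ both label $(\alpha,\beta)$-paths. For an equivalence $\kappa$ on $N$, the quotient $\Gamma/\kappa$ is the word graph with nodes $\{\min\alpha/\kappa:\alpha\in N\}$ and edges $(\min\alpha/\kappa,a,\min\beta/\kappa)$ whenever $(\alpha,a,\beta)\in E$. **Steps.** The input to the $i$-th step ($i\geq1$) is $(\Gamma_i,\kappa_i)$ with $\Gamma_i=(N_i,E_i)$ a word graph and $\kappa_i$ an equivalence relation on $N_i$; the output is $(\Gamma_{i+1},\kappa_{i+1})$. TC1: If $\alpha\in N_i$ and no edge of $\Gamma_i$ with source $\alpha$ is labelled by $a\in A$, then $\Gamma_{i+1}$ is $\Gamma_i$ with the new node $\beta:=1+\max\bigcup_{j\leq i}N_j$ and the edge $(\alpha,a,\beta)$ added; $\kappa_{i+1}:=\kappa_i\cup\{(\beta,\beta)\}$. TC2: Suppose that $\alpha\in N_i$ and $(u,v)\in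 R$, where $u=u_1a$ and $v=v_1b$ for some $u_1,v_1\in A^*$ and $a,b\in A$. (a) If $u$ and $v_1$ label paths from $\alpha$ to nodes $\beta,\gamma$ respectively, but $\gamma$ is not the source of any edge labelled $b$, then $\Gamma_{i+1}$ is $\Gamma_i$ with the edge $(\gamma,b,\beta)$ added, and $\kappa_{i+1}:=\kappa_i$. (b) The dual of (a): if $u_1$ and $v$ label paths from $\alpha$ to nodes $\beta,\gamma$ respectively, but $\beta$ is not the source of any edge labelled $a$, then the edge $(\beta,a,\gamma)$ is added, and $\kappa_{i+1}:=\kappa_i$. (c) If $u$ and $v$ label paths from $\alpha$ to nodes $\beta,\gamma$ respectively and $\beta\neq\gamma$, then $\Gamma_{i+1}:=\Gamma_i$ and $\kappa_{i+1}$ is the least equivalence containing $\kappa_i$ and $(\beta,\gamma)$. It may be that none of (a), (b), (c) holds, in which case nothing changes. TC3: $\Gamma_{i+1}:=\Gamma_i/\kappa_i$ and $\kappa_{i+1}$ is the least equivalence on $N_{i+1}$ containing every $(\beta,\gamma)$, $\beta\neq\gamma$, for which there are $\alpha\in N_{i+1}$, $a\in A$ with $(\alpha,a,\beta),(\alpha,a,\gamma)\in E_{i+1}$. **Congruence enumeration.** Let $S\subseteq A^*\times A^*$ be finite and let $\rho$ be the least right congruence on $A^*$ containing $R^{\#}$ and $S$. Let $\Gamma_1=(N_1,E_1)$ be a word graph with $(0)\pi_{\Gamma_1}\subseteq\rho$, and let $\kappa_1=\Delta_{N_1}$. A congruence enumeration for $\rho$ with input $(\Gamma_1,\kappa_1)$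 consists of: (a) for every $(u,v)\in S$, by repeatedly applying TC1 (if necessary), add edges to $\Gamma_1$ so that it contains paths labelled by $u$ and $v$ both with source $0$; (b) apply TC2 to $0$ and every $(u,v)\in S$ (with $(u,v)$ in the role of the relation). If $(\Gamma_m,\kappa_m)$ is the output of (a) and (b), then the enumeration is concluded by performing any sequence of applications of TC1, TC2, TC3 such that for every $i\geq m$: (c) if $\alpha\in N_i$ and there is no edge with source $\alpha$ and label $a\in A$ in $\Gamma_i$, then there is $j\geq i$ such that either $\alpha$ is no longer a node in $\Gamma_j$ or $\Gamma_j$ has an edge with source $\alpha$ and label $a$; (d) if $\alpha\in N_i$ and $(u,v)\in R$, then there is $j\geq i$ such that either $\alpha$ is no longer a node in $\Gamma_j$ or $(u,v)\in(\alpha)\pi_{\Gamma_j}$; (e) if $\kappa_i\neq\Delta_{N_i}$ then there is $j\geq i$ with $\kappa_j=\Delta_{N_j}$. A congruence enumeration for $R^{\#}$ is the case $S=\varnothing$, in which $\rho=R^{\#}$. A congruence enumeration terminates if the output $(\Gamma_i,\kappa_i)$ has the property that applying any of TC1, TC2, TC3 to $(\Gamma_i,\kappa_i)$ results in no change, i.e. $(\Gamma_{i+1},\kappa_{i+1})=(\Gamma_i,\kappa_i)$; its output word graph is then $\Gamma_i$.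
   Formalization: Part (a) additionally assumes that every node of the input word graph Γ_1 is reachable from 0; part (b) additionally assumes that Γ_1 is deterministic or that TC3 is applied at least once. Without these conditions the respective parts fail. *)

(* Defs.v *)
From HB Require Import structures.
From mathcomp Require Import all_boot generic_quotient.
From mathcomp Require Import boolp classical_sets functions cardinality.

Set Implicit Arguments.
Unset Strict Implicit.
Unset Printing Implicit Defensive.

Local Open Scope classical_set_scope.
Local Open Scope quotient_scope.

(** * Congruences and quotients of monoids *)

Definition equivalence_on {X : Type} (N : set X) (k : set (X * X)) : Prop :=
  [/\ k `<=` N `*` N,
      forall x, N x -> k (x, x),
      forall x y, k (x, y) -> k (y, x)
    & forall x y z, k (x, y) -> k (y, z) -> k (x, z)].

Definition diagonal {X : Type} (N : set X) : set (X * X) :=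
  [set xy | N xy.1 /\ xy.1 = xy.2].

Definition least_equivalence {X : Type} (N : set X) (P : set (X * X)) :
  set (X * X) := smallest (equivalence_on N) P.

Section Congruences.
Variable T : monoidType.
Local Open Scope group_scope.

Definition right_congruence (mu : set (T * T)) : Prop :=
  equivalence_on setT mu /\
  forall s t z : T, mu (s, t) -> mu (s * z, t * z).

Definition congruence (mu : set (T * T)) : Prop :=
  equivalence_on setT mu /\
  forall s t y z : T, mu (s, t) -> mu (y * s * z, y * t * z).

Definition least_congruence (P : set (T * T)) : set (T * T) :=
  smallest congruence P.

Definition least_right_congruence (P : set (T * T)) : set (T * T) :=
  smallest right_congruence P.

Lemma least_congruenceP (P : set (T * T)) : congruence (least_congruence P).
Proof.
split; first split => //.
- by move=> x _ mu [[[_ r _ _] _] _]; exact: r.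
- by move=> x y xy mu Hmu; have [[[_ _ s _] _] _] := Hmu; apply: s; exact: xy.
- move=> x y z xy yz mu Hmu; have [[[_ _ _ t] _] _] := Hmu.
  exact: (t x y z (xy _ Hmu) (yz _ Hmu)).
- move=> s t y z st mu Hmu; have [[_ c] _] := Hmu; apply: c; exact: st.
Qed.

Record congr := Congr {
  congr_rel :> set (T * T);
  congrP : congruence congr_rel }.

Definition generated_congr (P : set (T * T)) : congr :=
  Congr (least_congruenceP P).

Section Quotient.
Variable mu : congr.

Definition congr_bool : rel T := fun s t => `[< congr_rel mu (s, t) >].

Lemma congr_bool_refl : reflexive congr_bool.
Proof. by move=> s; apply/asboolP; have [[_ r _ _] _] := congrP mu; exact: r. Qed.

Lemma congr_bool_sym : symmetric congr_bool.
Proof.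
have [[_ _ sym _] _] := congrP mu.
by move=> s t; apply/asboolP/asboolP; exact: sym.
Qed.

Lemma congr_bool_trans : transitive congr_bool.
Proof.
have [[_ _ _ tr] _] := congrP mu.
by move=> t s u /asboolP st /asboolP tu; apply/asboolP; exact: tr st tu.
Qed.

Canonical congr_equiv :=
  EquivRel congr_bool congr_bool_refl congr_bool_sym congr_bool_trans.

Definition quotient := {eq_quot congr_equiv}%qT.

HB.instance Definition _ := Choice.on quotient.

Definition quotient_class (s : T) : quotient := \pi_({eq_quot congr_equiv})%qT s.

Definition quotient_mul (x y : quotient) : quotient :=
  quotient_class (repr x * repr y).

Lemma quotient_classP s t :
  quotient_class s = quotient_class t <-> congr_rel mu (s, t).
Proof. by split=> [/eqmodP/asboolP|st]; last exact/eqmodP/asboolP. Qed.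

Lemma quotient_repr s : congr_rel mu (repr (quotient_class s), s).
Proof. by apply/quotient_classP; rewrite /quotient_class reprK. Qed.

Lemma quotient_reprK (x : quotient) : quotient_class (repr x) = x.
Proof. exact: reprK. Qed.

Lemma quotient_classM s t :
  quotient_mul (quotient_class s) (quotient_class t) = quotient_class (s * t).
Proof.
apply/quotient_classP.
have [[_ _ _ tr] c] := congrP mu.
have h1 := c _ _ 1 (repr (quotient_class t)) (quotient_repr s).
have h2 := c _ _ s 1 (quotient_repr t).
by rewrite !mul1g in h1; rewrite !mulg1 in h2; exact: tr h1 h2.
Qed.

Lemma quotient_mulA : associative quotient_mul.
Proof.
move=> x y z.
rewrite -(quotient_reprK x) -(quotient_reprK y) -(quotient_reprK z).
by rewrite !quotient_classM mulgA.
Qed.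

Lemma quotient_mul1 : left_id (quotient_class 1) quotient_mul.
Proof. by move=> x; rewrite -(quotient_reprK x) quotient_classM mul1g. Qed.

Lemma quotient_1mul : right_id (quotient_class 1) quotient_mul.
Proof. by move=> x; rewrite -(quotient_reprK x) quotient_classM mulg1. Qed.

HB.instance Definition _ :=
  isMonoid.Build quotient quotient_mulA quotient_mul1 quotient_1mul.

End Quotient.
End Congruences.

(** * Right actions *)

Section Actions.
Local Open Scope group_scope.

Definition right_action {T : monoidType} {X : Type} (act : X -> T -> X) : Prop :=
  (forall x s t, act (act x s) t = act x (s * t)) /\ (forall x, act x 1 = x).

Definition action_kernel {T : monoidType} {X : Type} (act : X -> T -> X) :
  set (T * T) := [set st | forall x, act x st.1 = act x st.2].

Definition faithful {T : monoidType} {X : Type} (act : X -> T -> X) : Prop :=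
  action_kernel act = diagonal setT.

Definition isomorphic_actions {T : monoidType} {X Y : Type}
    (actX : X -> T -> X) (actY : Y -> T -> Y) : Prop :=
  exists2 f : X -> Y, bijective f & forall x s, f (actX x s) = actY (f x) s.

(** An action of [T] whose kernel contains [mu] is regarded as isomorphic to an
    action of [T / mu] when the action that it induces is. *)
Definition isomorphic_mod {T : monoidType} (mu : congr T) {X Y : Type}
    (actX : X -> T -> X) (actY : Y -> quotient mu -> Y) : Prop :=
  congr_rel mu `<=` action_kernel actX /\
  exists ind : X -> quotient mu -> X,
    [/\ forall x s, ind x (quotient_class mu s) = actX x s,
        right_action ind & isomorphic_actions ind actY].

Definition right_mult (T : monoidType) : T -> T -> T := fun x s => x * s.

End Actions.

(** * Words and word graphs *)

Definition word (A : Type) : Type := seq A.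

HB.instance Definition _ (A : choiceType) := Choice.on (word A).
HB.instance Definition _ (A : choiceType) :=
  isMonoid.Build (word A) (@catA A) (@cat0s A) (@cats0 A).

Record word_graph (A : Type) := WordGraph {
  nodes : set nat;
  edges : set (nat * A * nat) }.

Section WordGraphs.
Variable A : finType.
Implicit Types (G : word_graph A) (k : set (nat * nat)) (u v w : word A).

Definition is_word_graph G : Prop :=
  [/\ finite_set (nodes G), nodes G 0%N
    & forall al a be, edges G (al, a, be) -> nodes G al /\ nodes G be].

Fixpoint labels_path G (al : nat) w (be : nat) : Prop :=
  if w is a :: w' then exists2 ga, edges G (al, a, ga) & labels_path G ga w' be
  else nodes G al /\ al = be.

Definition has_edge G (al : nat) (a : A) : Prop :=
  exists be, edges G (al, a, be).

Definition path_relation G (al : nat) : set (word A * word A) :=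
  [set uv | exists be, labels_path G al uv.1 be /\ labels_path G al uv.2 be].

Definition deterministic G : Prop :=
  forall al a be ga,
    edges G (al, a, be) -> edges G (al, a, ga) -> be = ga.

(** A condition on input graphs: the inclusion of the path relation at 0 says
    nothing about nodes that no path from 0 meets, and these may survive in the
    output. *)
Definition reachable_from_0 G : Prop :=
  forall al, nodes G al -> exists w, labels_path G 0%N w al.

Definition class_min k (al be : nat) : Prop :=
  k (al, be) /\ forall ga, k (al, ga) -> (be <= ga)%N.

Definition graph_quotient G k : word_graph A :=
  WordGraph
    [set be | exists2 al, nodes G al & class_min k al be]
    [set e | exists al be, [/\ edges G (al, e.1.2, be),
                               class_min k al e.1.1 & class_min k be e.2]].

Definition state : Type := (word_graph A * set (nat * nat))%type.

Implicit Types s : state.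

(** [used] stands for the set of all the nodes that have ever been created, so
    that the new node is the successor of its maximum. *)
Definition TC1_at (al : nat) (a : A) (used : set nat) s s' : Prop :=
  [/\ nodes s.1 al, ~ has_edge s.1 al a
    & exists2 top, used top /\ (forall ga, used ga -> (ga <= top)%N)
      & s' = (WordGraph (nodes s.1 `|` [set top.+1])
                        (edges s.1 `|` [set (al, a, top.+1)]),
              s.2 `|` [set (top.+1, top.+1)])].

Definition TC1 (used : set nat) s s' : Prop :=
  exists al a, TC1_at al a used s s'.

Definition add_edge s (e : nat * A * nat) : state :=
  (WordGraph (nodes s.1) (edges s.1 `|` [set e]), s.2).

Definition TC2a (al : nat) u v s s' : Prop :=
  exists v1 b be ga, [/\ v = rcons v1 b, labels_path s.1 al u be,
    labels_path s.1 al v1 ga, ~ has_edge s.1 ga b & s' = add_edge s (ga, b, be)].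

Definition TC2b (al : nat) u v s s' : Prop :=
  exists u1 a be ga, [/\ u = rcons u1 a, labels_path s.1 al u1 be,
    labels_path s.1 al v ga, ~ has_edge s.1 be a & s' = add_edge s (be, a, ga)].

Definition TC2c (al : nat) u v s s' : Prop :=
  exists be ga, [/\ labels_path s.1 al u be, labels_path s.1 al v ga,
    be <> ga
    & s' = (s.1, least_equivalence (nodes s.1) (s.2 `|` [set (be, ga)]))].

(** If several of the cases apply (or one of them in several ways, which a
    nondeterministic graph allows), any of them may be performed. *)
Definition TC2_at (al : nat) u v s s' : Prop :=
  [/\ nodes s.1 al, u <> [::], v <> [::]
    & TC2a al u v s s' \/ TC2b al u v s s' \/ TC2c al u v s s' \/
      (s' = s /\ ~ exists s'', TC2a al u v s s'' \/ TC2b al u v s s'' \/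
                               TC2c al u v s s'')].

Definition TC2 (R : set (word A * word A)) s s' : Prop :=
  exists al u v, R (u, v) /\ TC2_at al u v s s'.

Definition nondeterminism G : set (nat * nat) :=
  [set bc | bc.1 <> bc.2 /\
    exists al a, edges G (al, a, bc.1) /\ edges G (al, a, bc.2)].

Definition TC3 s s' : Prop :=
  let G' := graph_quotient s.1 s.2 in
  s' = (G', least_equivalence (nodes G') (nondeterminism G')).

Definition step (R : set (word A * word A)) (used : set nat) s s' : Prop :=
  [\/ TC1 used s s', TC2 R s s' | TC3 s s'].

(** * Congruence enumerations *)

(** A finite or infinite sequence of states; [state_at i] is meaningful for
    [in_run r i] only, and the input is [state_at 0].  The steps with index
    below [start] are the preliminary ones that deal with the pairs in [S]. *)
Record run := Run {
  state_at : nat -> state;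
  last_index : option nat;
  start : nat }.

Implicit Type r : run.

Definition in_run r (i : nat) : Prop :=
  if last_index r is Some n then (i <= n)%N else True.

Definition graph_at r (i : nat) : word_graph A := (state_at r i).1.
Definition kappa_at r (i : nat) : set (nat * nat) := (state_at r i).2.

Definition used_nodes r (i : nat) : set nat :=
  \bigcup_(j in [set j | (j <= i)%N]) nodes (graph_at r j).

(** [TC1] adds an edge that is missing on the way of following, from node 0, a
    word that occurs in some pair in [S]. *)
Definition TC1_towards (S : set (word A * word A)) (used : set nat) s s' : Prop :=
  exists u v w1 a w2 al, [/\ S (u, v), u = w1 ++ a :: w2 \/ v = w1 ++ a :: w2,
    labels_path s.1 0%N w1 al & TC1_at al a used s s'].

Definition preliminary_steps (S : set (word A * word A)) r : Prop :=
  exists (k : nat) (l : seq (word A * word A)),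
    [/\ start r = (k + size l)%N /\ in_run r (start r),
        uniq l /\ S = [set uv | uv \in l],
        forall i, (i < k)%N ->
          TC1_towards S (used_nodes r i) (state_at r i) (state_at r i.+1),
        forall u v, S (u, v) ->
          (exists be, labels_path (graph_at r k) 0%N u be) /\
          (exists ga, labels_path (graph_at r k) 0%N v ga)
      & forall i, (i < size l)%N ->
          let uv := nth ([::], [::]) l i in
          TC2_at 0%N uv.1 uv.2 (state_at r (k + i)) (state_at r (k + i).+1)].

Definition congruence_enumeration (R S : set (word A * word A)) r : Prop :=
  [/\ [/\ is_word_graph (graph_at r 0),
          path_relation (graph_at r 0) 0%N
            `<=` least_right_congruence (least_congruence R `|` S)
        & kappa_at r 0 = diagonal (nodes (graph_at r 0))],
      preliminary_steps S r,
      forall i, (start r <= i)%N -> in_run r i.+1 ->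
        step R (used_nodes r i) (state_at r i) (state_at r i.+1)
    & forall i, (start r <= i)%N -> in_run r i ->
      [/\ forall al a, nodes (graph_at r i) al -> ~ has_edge (graph_at r i) al a ->
            exists j, [/\ (i <= j)%N, in_run r j
              & ~ nodes (graph_at r j) al \/ has_edge (graph_at r j) al a],
          forall al u v, nodes (graph_at r i) al -> R (u, v) ->
            exists j, [/\ (i <= j)%N, in_run r j
              & ~ nodes (graph_at r j) al \/
                path_relation (graph_at r j) al (u, v)]
        & kappa_at r i <> diagonal (nodes (graph_at r i)) ->
            exists j, [/\ (i <= j)%N, in_run r j
              & kappa_at r j = diagonal (nodes (graph_at r j))]]].

Definition terminates_at (R : set (word A * word A)) r (i : nat) : Prop :=
  [/\ (start r <= i)%N, in_run r i
    & forall s', step R (used_nodes r i) (state_at r i) s' -> s' = state_at r i].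

(** The input graph is deterministic, or TC3 is applied at least once.  Only
    TC3 can remove the nondeterminism of an input graph: without it, a run on a
    complete nondeterministic graph may go on forever applying TC2 to no effect. *)
Definition determinized r : Prop :=
  deterministic (graph_at r 0) \/
  exists i, [/\ (start r <= i)%N, in_run r i.+1
    & TC3 (state_at r i) (state_at r i.+1)].

End WordGraphs.

(* Main.v *)
Require Import Defs.
From mathcomp Require Import all_boot.
From mathcomp Require Import boolp classical_sets functions cardinality.

(** (a) The edges and kappa of every state are compatible with a map [c] from
    nodes to the quotient monoid sending 0 to 1.  After termination the graph is
    complete and deterministic and satisfies the relations at every node, so the
    free monoid acts on its nodes with kernel containing the congruence.  Every
    node is in the orbit of 0, so [c] is an isomorphism of actions.

    (b) Each step maps old nodes to new ones without increasing them, so every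
    node is eventually stable.  The stable nodes form a limit graph, complete,
    deterministic and satisfying the relations, on which the quotient monoid
    acts.  The orbits of the limits of the finitely many input nodes are finite
    if the monoid is, so all their edges are present from some stage on.  Every
    node is reached from the image of an input node, so at a later stage where
    kappa is trivial, hence the graph deterministic, these orbits make up the
    whole graph and no step changes it. *)

Set Implicit Arguments.
Unset Strict Implicit.
Unset Printing Implicit Defensive.

Local Open Scope classical_set_scope.

(** * Least equivalences, kernels of maps and actions, finite families of thresholds *)

Lemma smallest_sub (X : Type) (C : set (set X)) (P Q : set X) :
  C Q -> P `<=` Q -> smallest C P `<=` Q.
Proof. by move=> CQ PQ x; apply. Qed.

Lemma least_equivalenceP (X : Type) (N : set X) (P : set (X * X)) :
  P `<=` N `*` N -> equivalence_on N (least_equivalence N P).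
Proof.
move=> PN; split.
- apply: smallest_sub => //; split=> //.
  + by move=> x y [].
  + by move=> x y z [/= Nx _] [].
- by move=> x Nx k [[_ r _ _] _]; exact: r.
- by move=> x y kxy k kP; have [[_ _ s _] _] := kP; apply: s; exact: kxy.
- move=> x y z kxy kyz k kP; have [[_ _ _ t] _] := kP.
  exact: t (kxy _ kP) (kyz _ kP).
Qed.

Lemma diagonalP (X : Type) (N : set X) : equivalence_on N (Defs.diagonal N).
Proof.
split=> //.
- by move=> [x y] [/= Nx <-].
- by move=> x y [/= Nx <-].
- by move=> x y z [/= _ <-].
Qed.

(** Serves to bound least equivalences: for [c] to be constant on their classes, it is enough that
    [c] identifies the generating pairs. *)
Lemma kernel_equivalence (X Y : Type) (c : X -> Y) (N : set X) :
  equivalence_on N [set xy | [/\ N xy.1, N xy.2 & c xy.1 = c xy.2]].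
Proof.
split=> [[x y] [] //|x Nx //|x y [/= Nx Ny ->]//|].
by move=> x y z [/= Nx Ny ->] [].
Qed.

Lemma kernel_congruence (T : monoidType) (X : Type) (act : X -> T -> X) :
  right_action act -> congruence (action_kernel act).
Proof.
move=> [actM act1]; split; first split=> //.
- by move=> s t st x; rewrite st.
- by move=> s t u st tu x; rewrite st tu.
- by move=> s t y z st x /=; rewrite -!actM st.
Qed.

(** Acting on 1 recovers the acting element. *)
Lemma right_mult_faithful (T : monoidType) : faithful (@right_mult T).
Proof.
apply/seteqP; split=> [[s t] /= st|[s t] [_ /= ->] x //]; split=> //=.
by have := st 1%g; rewrite /right_mult /= !mul1g.
Qed.

Lemma finite_eventually (X : eqType) (D : set X) (P : X -> nat -> Prop) :
  finite_set D ->
  (forall x, D x -> exists i, forall j, (i <= j)%N -> P x j) ->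
  exists i, forall j, (i <= j)%N -> forall x, D x -> P x j.
Proof.
move=> /finite_seqP[l ->].
elim: l => [|y l IH] ex; first by exists 0%N.
have [i1 H1] := ex y (mem_head _ _).
have [|i2 H2] := IH; first by move=> x xl; apply: ex; rewrite /= inE xl orbT.
exists (maxn i1 i2) => j; rewrite geq_max => /andP[j1 j2] x /=.
by rewrite inE => /orP[/eqP ->|]; [exact: H1|exact: H2].
Qed.

(** * Paths in word graphs and the actions they define *)

Section Graphs.
Variable A : finType.
Implicit Types (G : word_graph A) (u v w : word A) (s : state A).

Definition edges_between_nodes G :=
  forall al a be, edges G (al, a, be) -> nodes G al /\ nodes G be.

Definition complete G := forall al a, nodes G al -> has_edge G al a.

Lemma path_nodes G al w be : edges_between_nodes G ->
  labels_path G al w be -> nodes G al /\ nodes G be.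
Proof.
move=> wfE; elim: w al => [|a w IH] al /= [].
- by move=> Nal <-.
- by move=> ga /wfE[Nal _] /IH[].
Qed.

Lemma path_cat G al u v be : edges_between_nodes G ->
  labels_path G al (u ++ v) be <->
  exists2 ga, labels_path G al u ga & labels_path G ga v be.
Proof.
move=> wfG; elim: u al => [|a u IH] al /=; split.
- by move=> p; exists al => //; split=> //; have [] := path_nodes wfG p.
- by move=> [ga [_ ->]].
- by move=> [de e /IH[ga p q]]; exists ga => //; exists de.
- by move=> [ga [de e p] q]; exists de => //; apply/IH; exists ga.
Qed.

Lemma path_edge G al a be : edges_between_nodes G ->
  labels_path G al [:: a] be <-> edges G (al, a, be).
Proof.
move=> wfE; split=> [[ga e [_ <-]]//|e].
by exists be => //; split=> //; have [] := wfE _ _ _ e.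
Qed.

Lemma path_rcons G al u a be : edges_between_nodes G ->
  labels_path G al (rcons u a) be <->
  exists2 ga, labels_path G al u ga & edges G (ga, a, be).
Proof.
move=> wfG; rewrite -cats1 path_cat //.
by split=> -[ga p e]; exists ga => //; move: e; rewrite path_edge.
Qed.

Lemma path_det G al w be ga : deterministic G ->
  labels_path G al w be -> labels_path G al w ga -> be = ga.
Proof.
move=> det; elim: w al => [|a w IH] al /=; first by move=> [_ <-] [_ <-].
by move=> [x e p] [y /(det _ _ _ _ e) <-]; exact: IH.
Qed.

Lemma path_map G G' (f : nat -> nat) al w be :
  (forall x, nodes G x -> nodes G' (f x)) ->
  (forall x a y, edges G (x, a, y) -> edges G' (f x, a, f y)) ->
  labels_path G al w be -> labels_path G' (f al) w (f be).
Proof.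
move=> fN fE; elim: w al => [|a w IH] al /=; first by move=> [/fN ? <-].
by move=> [ga /fE e /IH p]; exists (f ga).
Qed.

Lemma complete_path G al w : edges_between_nodes G -> complete G -> nodes G al ->
  exists be, labels_path G al w be.
Proof.
move=> wfE cG; elim: w al => [|a w IH] al Nal; first by exists al.
have [ga e] := cG al a Nal; have [_ Nga] := wfE _ _ _ e.
by have [be p] := IH _ Nga; exists be, ga.
Qed.

(** Completeness gives a path for every word, determinism makes its target unique, and concatenation
    of paths is the action law. *)
Lemma complete_action G : edges_between_nodes G -> deterministic G -> complete G ->
  exists2 phi : nodes G -> word A -> nodes G,
    forall al w be, phi al w = be <-> labels_path G (val al) w (val be)
    & right_action phi.
Proof.
move=> wfG det cG.
have /choice[phi phiP] (p : nodes G * word A) :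
    exists be : nodes G, labels_path G (val p.1) p.2 (val be).
  have [be pa] := complete_path p.2 wfG cG (set_mem (valP p.1)).
  have [_ Nbe] := path_nodes wfG pa.
  by exists (SigSub (mem_set Nbe)).
have phiE al w be : phi (al, w) = be <-> labels_path G (val al) w (val be).
  split=> [<-|p]; first exact: phiP.
  exact/val_inj/(path_det det (phiP _)).
exists (fun al w => phi (al, w)) => //; split=> [x s t|x].
- apply/esym/phiE/path_cat => //.
  by exists (val (phi (x, s))); exact: phiP.
- by apply/phiE; split=> //; exact: set_mem (valP x).
Qed.

(** The kernel of an action is a two-sided congruence, so only the pairs in [R] need checking; there
    the two paths given by the path relation are the only ones. *)
Lemma congruence_sub_kernel G (R : set (word A * word A))
    (phi : nodes G -> word A -> nodes G) :
  deterministic G ->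
  (forall al w be, phi al w = be <-> labels_path G (val al) w (val be)) ->
  right_action phi ->
  (forall al, nodes G al -> R `<=` path_relation G al) ->
  congr_rel (generated_congr R) `<=` action_kernel phi.
Proof.
move=> det phiE actphi relG; apply: smallest_sub; first exact: kernel_congruence.
move=> [u v] Ruv x /=.
have [be [/= pu pv]] := relG _ (set_mem (valP x)) _ Ruv.
apply: val_inj.
have /phiE qu := erefl (phi x u); have /phiE qv := erefl (phi x v).
by rewrite (path_det det qu pu) (path_det det qv pv).
Qed.

Lemma congruent_paths G (R : set (word A * word A)) al u v be :
  edges_between_nodes G -> deterministic G -> complete G ->
  (forall x, nodes G x -> R `<=` path_relation G x) ->
  congr_rel (generated_congr R) (u, v) ->
  labels_path G al u be -> labels_path G al v be.
Proof.
move=> wfG det cG relG uv p; have [Nal Nbe] := path_nodes wfG p.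
have [phi phiE actphi] := complete_action wfG det cG.
have := congruence_sub_kernel det phiE actphi relG uv (SigSub (mem_set Nal)).
by move=> /= e; apply/(phiE (SigSub (mem_set Nal)) v (SigSub (mem_set Nbe)));
  rewrite -e; apply/phiE.
Qed.

(** * The effect of one step on a state *)

Definition wf_state s := is_word_graph s.1 /\ equivalence_on (nodes s.1) s.2.

(** [f] records what each node becomes. The first clause makes iterated images stabilize and fixes
    0; the last ensures that every new node descends, along a path, from the image of an old one. *)
Definition evolves G G' (f : nat -> nat) : Prop :=
  [/\ forall al, nodes G al -> (f al <= al)%N,
      forall al, nodes G al -> nodes G' (f al),
      forall al a be, edges G (al, a, be) -> edges G' (f al, a, f be)
    & forall be, nodes G' be ->
        exists al w, nodes G al /\ labels_path G' (f al) w be].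

Lemma wf_edges s : wf_state s -> edges_between_nodes s.1.
Proof. by move=> [[]]. Qed.

Lemma class_min_exists s : wf_state s ->
  exists f : nat -> nat, forall al, nodes s.1 al -> class_min s.2 al (f al).
Proof.
move=> [_ [_ kr _ _]].
suff /choice[f fP] : forall al, exists be, nodes s.1 al -> class_min s.2 al be.
  by exists f.
move=> al; have [Nal|/asboolPn Nal] := pselect (nodes s.1 al); last first.
  (* Outside the node set, 0 is an arbitrary default that makes [f] total. *)
  by exists 0%N => /asboolP; rewrite (negbTE Nal).
have exk : exists be, `[< s.2 (al, be) >] by exists al; apply/asboolP/kr.
case: (ex_minnP exk) => be /asboolP kbe be_min.
by exists be => _; split=> // ga /asboolP /be_min.
Qed.

Lemma class_min_uniq (k : set (nat * nat)) al be ga :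
  class_min k al be -> class_min k al ga -> be = ga.
Proof.
by move=> [kb mb] [kg mg]; apply/eqP; rewrite eqn_leq mb ?mg.
Qed.

Lemma add_edge_wf s al a be : wf_state s -> nodes s.1 al -> nodes s.1 be ->
  wf_state (add_edge s (al, a, be)).
Proof.
move=> [[fin N0 wfE] ek] Nal Nbe; split=> //; split=> //.
by move=> x b y /= [/wfE//|[-> _ ->]].
Qed.

(** Cases (a) and (b) of TC2 are one case up to exchanging [u] and [v]. *)
Lemma TC2_cases (R : set (word A * word A)) s s' : wf_state s -> TC2 R s s' ->
  [\/ s' = s,
      exists al u v ga b be de,
        [/\ R (u, v) \/ R (v, u), labels_path s.1 al u be,
            v = rcons de b /\ labels_path s.1 al de ga,
            ~ has_edge s.1 ga b & s' = add_edge s (ga, b, be)]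
    | exists al u v be ga, [/\ R (u, v), labels_path s.1 al u be,
        labels_path s.1 al v ga
        & s' = (s.1, least_equivalence (nodes s.1) (s.2 `|` [set (be, ga)]))]].
Proof.
move=> wf [al [u [v [Ruv [Nal _ _ H]]]]].
case: H => [[v1 [b [be [ga [ev pu pv ne ->]]]]]|].
  by apply: Or32; exists al, u, v, ga, b, be, v1; split=> //; left.
case=> [[u1 [a [be [ga [eu pu pv ne ->]]]]]|].
  by apply: Or32; exists al, v, u, be, a, ga, u1; split=> //; right.
case=> [[be [ga [pu pv _ ->]]]|[-> _]]; last exact: Or31.
by apply: Or33; exists al, u, v, be, ga.
Qed.

Lemma evolves_id G G' : nodes G `<=` nodes G' -> edges G `<=` edges G' ->
  (forall be, nodes G' be ->
     exists al w, nodes G al /\ labels_path G' al w be) -> evolves G G' id.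
Proof. by move=> NG EG ex; split=> [//|al /NG //|al a be /EG //|//]. Qed.

Lemma evolves_same_nodes G G' : nodes G = nodes G' -> edges G `<=` edges G' ->
  evolves G G' id.
Proof.
move=> NG EG; apply: evolves_id => //; first by rewrite NG.
by move=> be Nbe; exists be, [::]; rewrite NG.
Qed.

(** The map is the identity for TC1 and TC2; for TC3 it sends a node to the minimum of its class,
    which explains why it never increases a node. *)
Lemma step_evolves (R : set (word A * word A)) (used : set nat) s s' :
  wf_state s -> step R used s s' ->
  wf_state s' /\ exists f, evolves s.1 s'.1 f.
Proof.
move=> wf; have [[fin N0 wfE] [kN kr ks kt]] := wf.
case=> [[al [a [Nal ne [top _ ->]]]]|/(TC2_cases wf)[->|H|H]|->].
- have wf' : is_word_graph (WordGraph (nodes s.1 `|` [set top.+1])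
                       (edges s.1 `|` [set (al, a, top.+1)])).
    split=> /=; [by rewrite finite_setU; split|by left|].
    move=> x b y [/wfE[Nx Ny]|[-> _ ->]]; first by split; left.
    by split; [left|right].
  split; first split=> //=.
  + split=> /=.
    * move=> [x y] [/kN[Nx Ny]|[-> ->]]; first by split; left.
      by split; right.
    * by move=> x [/kr kx|->]; [left|right].
    * by move=> x y [/ks kx|[-> ->]]; [left|right].
    * move=> x y z [kxy|[-> ->]]; last by move=> [kyz|[->]]; [left|right].
      move=> [kyz|[ey ->]]; first by left; exact: kt kyz.
      by left; move: kxy; rewrite ey.
  + exists id; apply: evolves_id => /=; try by left.
    move=> be [Nbe|->]; first by exists be, [::]; split=> //; split=> //; left.
    (* The created node is reached by the edge created with it. *)
    exists al, [:: a]; split=> //; apply/path_edge; [by case: wf'|by right].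
- by split=> //; exists id; exact: evolves_same_nodes.
- case: H => al [u [v [ga [b [be [de [_ pu [_ pv] _ ->]]]]]]].
  have [_ Nbe] := path_nodes (wf_edges wf) pu; have [_ Nga] := path_nodes (wf_edges wf) pv.
  split; first exact: add_edge_wf.
  by exists id; apply: evolves_same_nodes => // e; left.
- case: H => al [u [v [be [ga [_ pu pv ->]]]]].
  have [_ Nbe] := path_nodes (wf_edges wf) pu; have [_ Nga] := path_nodes (wf_edges wf) pv.
  split; last by exists id; exact: evolves_same_nodes.
  split=> //=; apply: least_equivalenceP => -[x y] [/kN//|[-> ->]//].
- have [f fP] := class_min_exists wf.
  have kN2 x y : s.2 (x, y) -> nodes s.1 y by move=> /kN[].
  have wf' : is_word_graph (graph_quotient s.1 s.2).
    split=> /=.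
    + by apply: sub_finite_set fin => x [al Nal [/kN2]].
    + by exists 0%N => //; split=> //; exact: kr.
    + move=> al a be [x [y [/= /wfE[Nx Ny] mx my]]].
      by split; [exists x|exists y].
  split; first split=> //=.
    apply: least_equivalenceP => -[x y] [_ [al [a [/= e1 e2]]]].
    by have [_ _ wfE'] := wf'; split; [have [] := wfE' _ _ _ e1|have [] := wfE' _ _ _ e2].
  exists f; split=> /=.
  + by move=> al Nal; have [_] := fP _ Nal; apply; exact: kr.
  + by move=> al Nal; exists al => //; exact: fP.
  + move=> al a be e; have [Nal Nbe] := wfE _ _ _ e.
    by exists al, be; split=> //; exact: fP.
  + move=> be [al Nal m]; exists al, [::]; split=> //=.
    rewrite (class_min_uniq (fP _ Nal) m); split=> //.
    by exists al.
Qed.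

(** * Nondeterminism, and states that no step changes *)

Lemma TC3_nondeterminism s s' : TC3 s s' -> nondeterminism s'.1 `<=` s'.2.
Proof. by move=> -> e ne k [_]; apply. Qed.

(** TC1 and TC2 add an edge only where its source has none with that label, and TC3 records all
    nondeterminism in the new kappa. *)
Lemma step_nondeterminism (R : set (word A * word A)) (used : set nat) s s' :
  wf_state s -> step R used s s' ->
  nondeterminism s.1 `<=` s.2 -> nondeterminism s'.1 `<=` s'.2.
Proof.
move=> wf st nd.
have add x a y : ~ has_edge s.1 x a ->
    forall G, edges G = edges s.1 `|` [set (x, a, y)] -> nondeterminism G `<=` s.2.
  move=> ne G EG [be ga] [/= bg [al [b [+ +]]]]; rewrite EG.
  move=> [e1|[ex1 eb1 ey1]] [e2|[ex2 eb2 ey2]].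
  - by apply: nd; split=> //; exists al, b.
  - by case: ne; exists be; rewrite -ex2 -eb2.
  - by case: ne; exists ga; rewrite -ex1 -eb1.
  - by case: bg; rewrite /= ey1 ey2.
case: st => [[al [a [Nal ne [top _ ->]]]]|/(TC2_cases wf)[->|H|H]|->] //.
- by move=> e He; left; exact: (add _ _ _ ne _ _ _ He).
- by case: H => al [u [v [ga [b [be [de [_ _ _ ne ->]]]]]]]; exact: (add _ _ _ ne).
- by case: H => al [u [v [be [ga [_ _ _ ->]]]]] e /nd ke k [_]; apply; left.
- by move=> e He k [_]; apply.
Qed.

Lemma nondeterminism_diagonal s :
  nondeterminism s.1 `<=` s.2 -> s.2 = Defs.diagonal (nodes s.1) -> deterministic s.1.
Proof.
move=> nd k al a be ga e1 e2; apply: contrapT => bg.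
have : s.2 (be, ga) by apply: nd; split=> //; exists al, a.
by rewrite k => -[].
Qed.

Lemma graph_quotient_diagonal G :
  is_word_graph G -> graph_quotient G (Defs.diagonal (nodes G)) = G.
Proof.
move=> [_ _ wfE].
have cm al be : nodes G al -> class_min (Defs.diagonal (nodes G)) al be <-> al = be.
  by move=> Nal; split=> [[[]]//|<-]; split=> // ga [_ /= <-].
case: G wfE cm => N E /= wfE cm; congr WordGraph; apply/seteqP; split.
- by move=> be [al Nal /(cm _ _ Nal) <-].
- by move=> be Nbe; exists be => //; apply/cm.
- move=> [[x a] y] [al [be [/= e]]]; have [Nal Nbe] := wfE _ _ _ e.
  by move=> /(cm _ _ Nal) <- /(cm _ _ Nbe) <-.
- move=> [[x a] y] e; have [Nx Ny] := wfE _ _ _ e.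
  by exists x, y; split=> //; apply/cm.
Qed.

(** Completeness excludes TC1 and cases (a), (b) of TC2, determinism together with the relations
    excludes case (c), and TC3 takes a quotient by equality. *)
Lemma terminal_state (R : set (word A * word A)) used s :
  wf_state s -> deterministic s.1 -> complete s.1 ->
  (forall al, nodes s.1 al -> R `<=` path_relation s.1 al) ->
  s.2 = Defs.diagonal (nodes s.1) ->
  forall s', step R used s s' -> s' = s.
Proof.
move=> wf det cG relG k s' [[al [a [Nal []]]]|[al [u [v [Ruv [Nal _ _ H]]]]]|->].
- exact: cG.
- case: H => [[v1 [b [be [ga [_ _ p []]]]]]|].
    by apply: cG; have [] := path_nodes (wf_edges wf) p.
  case=> [[u1 [a [be [ga [_ p _ []]]]]]|].
    by apply: cG; have [] := path_nodes (wf_edges wf) p.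
  case=> [[be [ga [pu pv []]]]|[]//].
  have [de [qu qv]] := relG _ Nal _ Ruv.
  by rewrite (path_det det pu qu) (path_det det pv qv).
- rewrite k graph_quotient_diagonal //; last by case: wf.
  case: s wf det k {cG relG} => G k /= wf det ->; congr pair.
  apply/seteqP; split.
    apply: smallest_sub; first exact: diagonalP.
    by move=> [be ga] [/= bg [al [a [e1 e2]]]]; case: bg; exact: det e1 e2.
  by move=> [x y] [/= Nx <-] l [[_ r _ _] _]; exact: r.
Qed.

(** * The limit graph of an infinite run *)

Section Limit.
Variables (R : set (word A * word A)) (st : nat -> state A).
Variables (f : nat -> nat -> nat).
Local Notation g i := (st i).1.
Hypothesis wf : forall i, wf_state (st i).
Hypothesis ev : forall i, evolves (g i) (g i.+1) (f i).
Hypothesis nondet : exists i0, forall i, (i0 <= i)%N ->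
  nondeterminism (g i) `<=` (st i).2.
Hypothesis edge_added : forall i al a,
  nodes (g i) al -> ~ has_edge (g i) al a ->
  exists2 j, (i <= j)%N & ~ nodes (g j) al \/ has_edge (g j) al a.
Hypothesis relation_added : forall i al u v, nodes (g i) al -> R (u, v) ->
  exists2 j, (i <= j)%N & ~ nodes (g j) al \/ path_relation (g j) al (u, v).
Hypothesis kappa_trivial : forall i,
  exists2 j, (i <= j)%N & (st j).2 = Defs.diagonal (nodes (g j)).

(** The node that [al], a node at stage [i], has become at stage [i + n]. *)
Fixpoint push (i n al : nat) : nat :=
  if n is n'.+1 then f (i + n') (push i n' al) else al.

Definition stable (i al : nat) : Prop :=
  nodes (g i) al /\ forall j, (i <= j)%N -> f j al = al.

Lemma push_nodes i n al : nodes (g i) al -> nodes (g (i + n)) (push i n al).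
Proof.
move=> Nal; elim: n => [|n IH] /=; first by rewrite addn0.
by rewrite addnS; have [_ fN _ _] := ev (i + n); exact: fN.
Qed.

Lemma push_edge i n al a be : edges (g i) (al, a, be) ->
  edges (g (i + n)) (push i n al, a, push i n be).
Proof.
move=> e; elim: n => [|n IH] /=; first by rewrite addn0.
by rewrite addnS; have [_ _ fE _] := ev (i + n); exact: fE.
Qed.

Lemma push_path i n al w be : labels_path (g i) al w be ->
  labels_path (g (i + n)) (push i n al) w (push i n be).
Proof.
by apply: path_map => [x|x a y]; [exact: push_nodes|exact: push_edge].
Qed.

Lemma push_stable i n al : stable i al -> push i n al = al.
Proof. by move=> [_ fx]; elim: n => //= n ->; rewrite fx ?leq_addr. Qed.

Lemma stable_leq i j al : (i <= j)%N -> stable i al -> stable j al.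
Proof.
move=> ij sal; split; last by move=> k jk; have [_] := sal; apply; exact: leq_trans jk.
have [Nal _] := sal; have := push_nodes (j - i) Nal.
by rewrite push_stable // subnKC.
Qed.

Lemma push_le i n m al : nodes (g i) al -> (n <= m)%N ->
  (push i m al <= push i n al)%N.
Proof.
move=> Nal /subnK <-; elim: (m - n)%N => // d IH; apply: leq_trans IH => /=.
by have [le _ _ _] := ev (i + (d + n)); apply: le; exact: push_nodes.
Qed.

(** The successive images of a node form a nonincreasing sequence of natural numbers, so they are
    constant once their minimum is attained. *)
Lemma stabilizes i al : nodes (g i) al ->
  exists m, stable (i + m) (push i m al) /\
    forall n, (m <= n)%N -> push i n al = push i m al.
Proof.
move=> Nal.
have exv : exists be, `[< exists n, push i n al = be >].
  by exists al; apply/asboolP; exists 0%N.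
case: (ex_minnP exv) => be /asboolP[m pm] be_min.
have cst n : (m <= n)%N -> push i n al = push i m al.
  move=> mn; apply/eqP; rewrite eqn_leq push_le //= pm; apply: be_min.
  by apply/asboolP; exists n.
exists m; split=> //; split; first exact: push_nodes.
move=> j imj; have mj : (m <= j - i)%N by rewrite leq_subRL // (leq_trans _ imj) ?leq_addr.
have ij : (i <= j)%N by rewrite (leq_trans _ imj) ?leq_addr.
have := cst (j - i).+1 (leqW mj).
by rewrite /= subnKC // cst.
Qed.

Lemma reached_from_initial j be : nodes (g j) be ->
  exists al w, nodes (g 0) al /\ labels_path (g j) (push 0 j al) w be.
Proof.
elim: j be => [|j IH] be Nbe; first by exists be, [::].
have [_ fN fE re] := ev j.
have [ga [w [/IH[al [v [Nal p]]] q]]] := re _ Nbe.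
exists al, (v ++ w); split=> //; apply/path_cat; first exact: wf_edges.
by exists (f j ga) => //=; rewrite add0n; apply: path_map p.
Qed.

(** This yields arbitrarily late stages rather than all late ones. It can still be combined with
    properties of the limit graph, which persist from some stage on. *)
Lemma eventually_deterministic i : exists2 j, (i <= j)%N &
  deterministic (g j) /\ (st j).2 = Defs.diagonal (nodes (g j)).
Proof.
have [i0 nd] := nondet; have [j] := kappa_trivial (maxn i i0).
rewrite geq_max => /andP[ij i0j] kj; exists j => //; split=> //.
exact: nondeterminism_diagonal (nd _ i0j) kj.
Qed.

(** Both ends of an edge are required to be stable at the stage where it occurs, so that the edge
    itself survives unchanged at every later stage. *)
Definition limit_graph : word_graph A :=
  WordGraph [set al | exists i, stable i al]
    [set e | exists i, [/\ stable i e.1.1, stable i e.2 & edges (g i) e]].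

Lemma limit_edges : edges_between_nodes limit_graph.
Proof. by move=> al a be [i [/= s1 s2 _]]; split; exists i. Qed.

Lemma limit_edge_eventually al a be : edges limit_graph (al, a, be) ->
  exists i, forall j, (i <= j)%N -> edges (g j) (al, a, be).
Proof.
move=> [i [/= sa sb e]]; exists i => j ij.
by have := push_edge (j - i) e; rewrite !push_stable // subnKC.
Qed.

Lemma limit_path_eventually al w be : labels_path limit_graph al w be ->
  exists i, forall j, (i <= j)%N -> labels_path (g j) al w be.
Proof.
elim: w al => [|a w IH] al /=.
  by move=> [[i sal] <-]; exists i => j /stable_leq/(_ sal)[].
move=> [ga /limit_edge_eventually[i1 e] /IH[i2 p]]; exists (maxn i1 i2) => j.
by rewrite geq_max => /andP[/e ? /p ?]; exists ga.
Qed.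

Lemma limit_deterministic : deterministic limit_graph.
Proof.
move=> al a be ga /limit_edge_eventually[i1 e1] /limit_edge_eventually[i2 e2].
have [j] := eventually_deterministic (maxn i1 i2).
by rewrite geq_max => /andP[/e1 h1 /e2 h2] [det _]; exact: det h1 h2.
Qed.

Lemma limit_complete : complete limit_graph.
Proof.
move=> al a [i sal].
have [j ij [be e]] : exists2 j, (i <= j)%N & has_edge (g j) al a.
  have [h|h] := pselect (has_edge (g i) al a); first by exists i.
  have [j ij [[]|]] := edge_added sal.1 h; last by exists j.
  by have [] := stable_leq ij sal.
(* The target [be] need not be stable yet; its eventual image is, while the source [al] no longer
   moves. *)
have [_ Nbe] := wf_edges (wf j) e; have [m [sbe _]] := stabilizes Nbe.
have sal' := stable_leq ij sal.
exists (push j m be), (j + m)%N; split=> //=.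
  exact: stable_leq (leq_addr _ _) sal'.
by have := push_edge m e; rewrite push_stable.
Qed.

Lemma limit_relations al : nodes limit_graph al -> R `<=` path_relation limit_graph al.
Proof.
move=> Nal [u v] Ruv.
have [be pu] := complete_path u limit_edges limit_complete Nal.
have [ga pv] := complete_path v limit_edges limit_complete Nal.
have [[i0 sal] [i1 pu']] := (Nal, limit_path_eventually pu).
have [i2 pv'] := limit_path_eventually pv.
have [j ij [de [/= qu qv]]] :
    exists2 j, (i0 <= j)%N & path_relation (g j) al (u, v).
  have [j ij [[]|]] := relation_added sal.1 Ruv; last by exists j.
  by have [] := stable_leq ij sal.
(* At a deterministic stage [l] that contains both limit paths, the images of the two paths to [de]
   start at [al] as well, so [be] and [ga] both equal the image of [de]. *)
have [l] := eventually_deterministic (maxn j (maxn i1 i2)).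
rewrite !geq_max => /and3P[jl i1l i2l] [det _].
have sal' := stable_leq ij sal.
have := push_path (l - j) qu; have := push_path (l - j) qv.
rewrite subnKC // push_stable // => rv ru; exists be; split=> //=.
rewrite (path_det det (pu' _ i1l) ru) -(path_det det (pv' _ i2l) rv).
exact: pv.
Qed.

Lemma eventually_terminal :
  finite_set [set: quotient (generated_congr R)] ->
  exists i, [/\ deterministic (g i), complete (g i),
    forall al, nodes (g i) al -> R `<=` path_relation (g i) al
    & (st i).2 = Defs.diagonal (nodes (g i))].
Proof.
move=> finM; pose L := limit_graph.
have [fin0 _ _] := (wf 0).1.
have /choice[lim limP] : forall n, exists l, nodes (g 0) n ->
    exists m, stable m l /\ forall j, (m <= j)%N -> push 0 j n = l.
  move=> n; have [Nn|/asboolPn Nn] := pselect (nodes (g 0) n); last first.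
    by exists 0%N => /asboolP; rewrite (negbTE Nn).
  have [m [sm cst]] := stabilizes Nn.
  by exists (push 0 m n) => _; exists m; split=> // j /cst.
have limN n : nodes (g 0) n -> nodes L (lim n).
  by move=> /limP[m [sm _]]; exists m.
(* The union of the orbits, in the limit graph, of the limits of the input nodes. *)
pose B := [set be | exists n w, nodes (g 0) n /\ labels_path L (lim n) w be].
have BL be : B be -> nodes L be.
  by move=> [n [w [_ /(path_nodes limit_edges)[]]]].
(* Congruent words lead from a node of the limit graph to the same node, so [B] is covered by the
   image of the pairs of an input node and an element of the quotient. *)
have finB : finite_set B.
  have /choice[h hP] : forall nq : nat * quotient (generated_congr R),
      exists be, nodes (g 0) nq.1 -> labels_path L (lim nq.1) (repr nq.2) be.
    move=> [n q] /=; have [Nn|/asboolPn Nn] := pselect (nodes (g 0) n); last first.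
      by exists 0%N => /asboolP; rewrite (negbTE Nn).
    have [be p] := complete_path (repr q) limit_edges limit_complete (limN _ Nn).
    by exists be.
  apply: sub_finite_set (finite_image h (finite_setX fin0 finM)).
  move=> be [n [w [Nn p]]].
  exists (n, quotient_class (generated_congr R) w) => //=.
  apply: (path_det limit_deterministic) p.
  apply: (congruent_paths limit_edges limit_deterministic limit_complete
    limit_relations (quotient_repr _ _)).
  exact: (hP (n, _)).
have BE al a be : B al -> edges L (al, a, be) -> B be.
  move=> [n [w [Nn p]]] e; exists n, (rcons w a); split=> //.
  by apply/path_rcons; [exact: limit_edges|exists al].
(* From [i1] on the input nodes have reached their limits; from [i2] on all limit edges leaving [B]
   are present. Both use that only finitely many conditions are imposed. *)
have [i1 Hi1] : exists i, forall j, (i <= j)%N -> forall n, nodes (g 0) n ->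
    push 0 j n = lim n.
  by apply: finite_eventually => // n /limP[m [_ cst]]; exists m.
have [i2 Hi2] : exists i, forall j, (i <= j)%N -> forall x : nat * A,
    (B `*` setT) x ->
    exists2 be, edges L (x.1, x.2, be) & edges (g j) (x.1, x.2, be).
  apply: finite_eventually; first exact: finite_setX finB finite_finset.
  move=> [al a] [/= /BL Nal _]; have [be e] := limit_complete a Nal.
  by have [i ie] := limit_edge_eventually e; exists i => j /ie; exists be.
have [j] := eventually_deterministic (maxn i1 i2).
rewrite geq_max => /andP[/Hi1 {}Hi1 /Hi2 {}Hi2] [det kj].
(* By determinism at stage [j], an edge leaving [B] must be the limit edge already present there,
   and its target is again in [B]. *)
have toL al w be : B al -> labels_path (g j) al w be -> labels_path L al w be.
  elim: w al => [|a w IH] al Bal /=; first by move=> [_ <-]; split=> //; exact: BL.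
  move=> [x e p]; have [//|/= y e' e''] := Hi2 (al, a).
  move: p; rewrite (det _ _ _ _ e e'') => /IH p; exists y => //.
  by apply: p; exact: BE Bal e'.
have NB be : nodes (g j) be -> B be.
  move=> /reached_from_initial[n [w [Nn]]]; rewrite (Hi1 _ Nn) => p.
  exists n, w; split=> //; apply: toL p; exists n, [::]; split=> //; split=> //.
  exact: limN.
have cG : complete (g j).
  by move=> al a /NB Bal; have [//|/= y _ e] := Hi2 (al, a); exists y.
exists j; split=> // al Nal [u v] Ruv.
have [be [/= pu pv]] := limit_relations (BL _ (NB _ Nal)) Ruv.
have [x qu] := complete_path u (wf_edges (wf j)) cG Nal.
have [y qv] := complete_path v (wf_edges (wf j)) cG Nal.
exists be; split=> /=.
- by rewrite (path_det limit_deterministic pu (toL _ _ _ (NB _ Nal) qu)).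
- by rewrite (path_det limit_deterministic pv (toL _ _ _ (NB _ Nal) qv)).
Qed.

End Limit.

(** * Compatible maps from nodes to the quotient monoid *)

Section Compatible.
Variable R : set (word A * word A).
Local Notation M := (quotient (generated_congr R)).
Local Notation cls := (quotient_class (generated_congr R)).

(** When every node is reachable from 0, such a [c] exists iff the path relation
    at 0 is contained in the congruence and nodes identified by kappa have
    congruent labels; unlike the path relation, it is easily followed through a
    step. *)
Definition compatible s (c : nat -> M) : Prop :=
  [/\ c 0 = 1%g,
      forall al a be, edges s.1 (al, a, be) -> c be = (c al * cls [:: a])%g
    & forall al be, s.2 (al, be) -> c al = c be].

Lemma classM u v : (cls u * cls v)%g = cls (u ++ v).
Proof. exact: quotient_classM. Qed.

Lemma class_relation u v : R (u, v) -> cls u = cls v.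
Proof. by move=> Ruv; apply/quotient_classP => mu [_]; apply. Qed.

Lemma compatible_path s c al w be : compatible s c ->
  labels_path s.1 al w be -> c be = (c al * cls w)%g.
Proof.
move=> [_ cE _]; elim: w al => [|a w IH] al /=.
  by move=> [_ <-]; rewrite mulg1.
by move=> [ga /cE e /IH ->]; rewrite e -mulgA classM.
Qed.

Lemma initial_compatible G : reachable_from_0 G -> is_word_graph G ->
  path_relation G 0 `<=` least_congruence R ->
  exists c, compatible (G, Defs.diagonal (nodes G)) c.
Proof.
move=> reach [_ N0 wfE] piR.
have /choice[w wP] : forall al, exists w, nodes G al -> labels_path G 0 w al.
  move=> al; have [/reach[w p]|/asboolPn Nal] := pselect (nodes G al).
    by exists w.
  by exists [::] => /asboolP; rewrite (negbTE Nal).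
(* The class of a chosen label of a path from 0. Any two such labels of one node are congruent by
   [piR], which settles both the value at 0 and the edges. *)
exists (fun al => cls (w al)); split=> /=.
- suff /quotient_classP : congr_rel (generated_congr R) (w 0%N, [::]) by [].
  by apply: piR; exists 0%N; split=> //=; exact: wP.
- move=> al a be e; have [Nal Nbe] := wfE _ _ _ e; rewrite classM.
  apply/quotient_classP; apply: piR; exists be; split=> /=; first exact: wP.
  by apply/path_cat => //; exists al; [exact: wP|exact/path_edge].
- by move=> al be [_ /= ->].
Qed.

Lemma step_compatible used s s' c : wf_state s -> nodes s.1 `<=` used ->
  step R used s s' -> compatible s c -> exists c', compatible s' c'.
Proof.
move=> wf Nused st cc; have [c0 cE ck] := cc.
have [[_ N0 wfE] [kN kr _ _]] := wf.
have wfE' := wf_edges (step_evolves wf st).1.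
case: st wfE' => [[al [a [Nal ne [top [_ topP] ->]]]]|/(TC2_cases wf)[->|H|H]|->] wfE'.
(* The created number exceeds all used ones, so [c] may be redefined there, with the value forced by
   the new edge. *)
- have old x : nodes s.1 x -> (x == top.+1) = false.
    by move=> /Nused/topP xt; apply/negbTE; rewrite neq_ltn ltnS xt.
  exists (fun x => if x == top.+1 then (c al * cls [:: a])%g else c x).
  split=> //=.
  + move=> x b y [e|[-> -> ->]]; last by rewrite eqxx old.
    by have [Nx Ny] := wfE _ _ _ e; rewrite !old //; exact: cE.
  + move=> x y [kxy|[-> ->]] //.
    by have [/= Nx Ny] := kN _ kxy; rewrite !old //; exact: ck.
- by exists c.
- case: H => al [u [v [ga [b [be [de [Ruv pu [ev pv] _ ->]]]]]]].
  exists c; split=> //= x y z [/cE //|[-> -> ->]].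
  have euv : cls u = cls v by case: Ruv => /class_relation.
  rewrite (compatible_path cc pu) (compatible_path cc pv) euv ev.
  by rewrite -mulgA classM cats1.
- case: H => al [u [v [be [ga [Ruv pu pv ->]]]]].
  exists c; split=> //= x y kxy.
  have [|_ _ //] := smallest_sub (kernel_equivalence c (nodes s.1)) _ kxy.
  move=> [x' y'] /= [kx|[-> ->]].
    by have [/= Nx Ny] := kN _ kx; split=> //; exact: ck.
  have [_ Nbe] := path_nodes (wf_edges wf) pu.
  have [_ Nga] := path_nodes (wf_edges wf) pv.
  by rewrite (compatible_path cc pu) (compatible_path cc pv) (class_relation Ruv).
(* A quotient edge comes from an edge between members of the same classes, on which [c] is constant.
   Hence two edges with common source and label have targets of equal value. *)
- have cE' al a be : edges (graph_quotient s.1 s.2) (al, a, be) ->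
      c be = (c al * cls [:: a])%g.
    by move=> [x [y [/= /cE e [/ck <- _] [/ck <- _]]]].
  exists c; split=> //= x y kxy.
  have [|_ _ //] := smallest_sub (kernel_equivalence c _) _ kxy.
  move=> [x' y'] /= [_ [al [a [e1 e2]]]]; have [_ Nx] := wfE' _ _ _ e1.
  by have [_ Ny] := wfE' _ _ _ e2; split=> //=; rewrite (cE' _ _ _ e1) (cE' _ _ _ e2).
Qed.

End Compatible.

(** * Invariants and fairness along an enumeration *)

Section Runs.
Variables (R : set (word A * word A)) (r : run A).
Hypothesis enum : congruence_enumeration R set0 r.

(** With no pairs to process, the list [l] is empty, and a preliminary TC1 would need a word from
    some pair. *)
Lemma enumeration_start : start r = 0%N.
Proof.
have [_ [k [l [[-> _] [_ Sl] TC1k _ _]]] _ _] := enum.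
case: k TC1k => [|k] TC1k.
  case: l Sl => // x l Sl; suff : set0 x by []. by rewrite Sl /= mem_head.
by have [u [v [w1 [a [w2 [al [[]]]]]]]] := TC1k 0%N isT.
Qed.

Lemma in_run_leq i j : (i <= j)%N -> in_run r j -> in_run r i.
Proof. by rewrite /in_run; case: last_index => // n; exact: leq_trans. Qed.

Lemma run_step i : in_run r i.+1 ->
  step R (used_nodes r i) (state_at r i) (state_at r i.+1).
Proof. by have [_ _ H _] := enum; apply: H; rewrite enumeration_start. Qed.

Lemma run_wf i : in_run r i -> wf_state (state_at r i).
Proof.
elim: i => [_|i IH ri].
  have [[wfG _ k] _ _ _] := enum; split=> //.
  by rewrite -/(kappa_at r 0) k; exact: diagonalP.
by have [] := step_evolves (IH (in_run_leq (leqnSn i) ri)) (run_step ri).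
Qed.

Lemma run_reachable i : reachable_from_0 (graph_at r 0) -> in_run r i ->
  reachable_from_0 (graph_at r i).
Proof.
move=> reach; elim: i => [//|i IH ri] be Nbe.
have ri' := in_run_leq (leqnSn i) ri; have wf := run_wf ri'.
have [wf' [f [fle fN fE re]]] := step_evolves wf (run_step ri).
have [al [w [Nal q]]] := re _ Nbe; have [v p] := IH ri' _ Nal.
have [_ N0 _] := wf.1.
have f0 : f 0%N = 0%N by apply/eqP; rewrite -leqn0; exact: fle.
exists (v ++ w); apply/path_cat; first exact: wf_edges wf'.
by exists (f al) => //; rewrite -f0; exact: path_map p.
Qed.

Lemma run_compatible i : reachable_from_0 (graph_at r 0) -> in_run r i ->
  exists c, compatible (R := R) (state_at r i) c.
Proof.
move=> reach; have [[wfG piR k] _ _ _] := enum; elim: i => [_|i IH ri].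
  have piR' : path_relation (graph_at r 0) 0%N `<=` least_congruence R.
    apply: subset_trans piR (smallest_sub _ _) => [|x [|[]] //].
    have [eqR cR] := least_congruenceP R; split=> // x y z xy.
    by have := cR _ _ 1%g z xy; rewrite !mul1g.
  have [c] := initial_compatible reach wfG piR'.
  by rewrite -k -surjective_pairing; exists c.
have ri' := in_run_leq (leqnSn i) ri; have [c cc] := IH ri'.
apply: step_compatible (run_wf ri') _ (run_step ri) cc.
by move=> x Nx; exists i => /=.
Qed.

Lemma run_nondeterminism : determinized r ->
  exists2 i0, in_run r i0 & forall i, (i0 <= i)%N -> in_run r i ->
    nondeterminism (graph_at r i) `<=` kappa_at r i.
Proof.
move=> dr.
suff [i0 ri0 nd] : exists2 i0, in_run r i0 &
    nondeterminism (graph_at r i0) `<=` kappa_at r i0.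
  exists i0 => //; elim=> [|i IH]; first by rewrite leqn0 => /eqP <-.
  rewrite leq_eqVlt => /orP[/eqP <- //|/IH {}IH ri].
  have ri' := in_run_leq (leqnSn i) ri.
  exact: step_nondeterminism (run_wf ri') (run_step ri) (IH ri').
case: dr => [det|[i [_ ri e]]].
  exists 0%N; first by rewrite -enumeration_start; have [_ [k [l [[]]]]] := enum.
  by move=> [x y] [/= xy [al [a [e1 e2]]]]; case: xy; exact: det e1 e2.
by exists i.+1 => //; exact: TC3_nondeterminism e.
Qed.

Lemma run_fair i : in_run r i ->
  [/\ forall al a, nodes (graph_at r i) al -> ~ has_edge (graph_at r i) al a ->
        exists j, [/\ (i <= j)%N, in_run r j
          & ~ nodes (graph_at r j) al \/ has_edge (graph_at r j) al a],
      forall al u v, nodes (graph_at r i) al -> R (u, v) ->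
        exists j, [/\ (i <= j)%N, in_run r j
          & ~ nodes (graph_at r j) al \/
            path_relation (graph_at r j) al (u, v)]
    & exists j, [/\ (i <= j)%N, in_run r j
        & kappa_at r j = Defs.diagonal (nodes (graph_at r j))]].
Proof.
move=> ri; have [_ _ _ /(_ i)[]] := enum; rewrite ?enumeration_start //.
move=> hc hd he; split=> //.
have [k|/he //] := pselect (kappa_at r i = Defs.diagonal (nodes (graph_at r i))).
by exists i.
Qed.

(** Termination is expressed with the nodes used up to [i]. Strong induction shows that all states
    since [i] agree, so the used nodes, on which TC1 depends, are the same. *)
Lemma constant_after_termination i j : terminates_at R r i ->
  (i <= j)%N -> in_run r j -> state_at r j = state_at r i.
Proof.
move=> [_ _ stop]; elim/ltn_ind: j => -[|j] IH.
  by rewrite leqn0 => /eqP ->.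
rewrite leq_eqVlt => /orP[/eqP -> //|ij rj].
have cst l : (l <= j)%N -> (i <= l)%N -> state_at r l = state_at r i.
  by move=> lj il; apply: IH => //; exact: in_run_leq (leqW lj) rj.
apply: stop; have := run_step rj; rewrite cst //.
suff -> : used_nodes r j = used_nodes r i by [].
apply/seteqP; split=> x [l /= lj Nx]; last by exists l => //=; exact: leq_trans lj ij.
have [li|/ltnW il] := leqP l i; first by exists l.
by exists i => //=; rewrite /graph_at -(cst l).
Qed.

(** What fairness promises for a later stage holds now if the state never changes again. This covers
    terminated runs and also the last state of a finite run. *)
Lemma settled i : in_run r i ->
  (forall j, (i <= j)%N -> in_run r j -> state_at r j = state_at r i) ->
  [/\ complete (graph_at r i),
      forall al, nodes (graph_at r i) al -> R `<=` path_relation (graph_at r i) al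
    & kappa_at r i = Defs.diagonal (nodes (graph_at r i))].
Proof.
move=> ri cst; have [hc hd he] := run_fair ri; split.
- move=> al a Nal; apply: contrapT => ne; have [j [ij rj]] := hc _ _ Nal ne.
  by rewrite /graph_at cst // => -[].
- move=> al Nal [u v] Ruv; have [j [ij rj]] := hd _ _ _ Nal Ruv.
  by rewrite /graph_at cst // => -[].
- by have [j [ij rj]] := he; rewrite /kappa_at /graph_at cst.
Qed.

End Runs.

End Graphs.

(** * Termination versus finiteness of the quotient monoid *)

Theorem corollary4p2 (A : finType) (R : set (word A * word A))
    (finR : finite_set R) :
  (forall (r : run A) (i : nat),
      congruence_enumeration R set0 r ->
      reachable_from_0 (graph_at r 0) ->
      terminates_at R r i ->
      finite_set [set: quotient (generated_congr R)] /\
      exists phi : nodes (graph_at r i) -> word A -> nodes (graph_at r i),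
        [/\ forall al w be,
              phi al w = be <-> labels_path (graph_at r i) (val al) w (val be),
            right_action phi,
            isomorphic_mod phi (@right_mult (quotient (generated_congr R)))
          & faithful (@right_mult (quotient (generated_congr R)))])
  /\
  (finite_set [set: quotient (generated_congr R)] ->
   forall r : run A,
     congruence_enumeration R set0 r ->
     determinized r ->
     exists i, terminates_at R r i).
Proof.
split=> [r i enum reach term|finM r enum dr].
  have [_ ri stop] := term.
  have [cG relG k] := settled enum ri (fun j => constant_after_termination enum term).
  have wf := run_wf enum ri; have reachG := run_reachable enum reach ri.
  have [c cc] := run_compatible enum reach ri.
  have [fin N0 _] := wf.1.
  (* TC3 leaves the terminal state unchanged, so that state is itself an output of TC3: its
     nondeterminism lies in kappa, which is trivial. *)
  have det : deterministic (graph_at r i).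
    have e := stop _ (Or33 _ _ erefl).
    apply: nondeterminism_diagonal k.
    by apply: (@TC3_nondeterminism _ (state_at r i)); rewrite /TC3 -[LHS]e.
  have wfE := wf_edges wf.
  have [phi phiE actphi] := complete_action wfE det cG.
  have kerphi := congruence_sub_kernel det phiE actphi relG.
  have [c0 _ _] := cc.
  have csurj q : exists2 al, nodes (graph_at r i) al & c al = q.
    have [al p] := complete_path (repr q) wfE cG N0.
    have [_ Nal] := path_nodes wfE p; exists al => //.
    by rewrite (compatible_path cc p) c0 mul1g quotient_reprK.
  (* Equal values mean that words leading from 0 to [al] and to [be] are congruent, hence lead to
     the same node. Reachability supplies these words. *)
  have cinj al be : nodes (graph_at r i) al -> nodes (graph_at r i) be ->
      c al = c be -> al = be.
    move=> /reachG[u p] /reachG[v q].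
    rewrite (compatible_path cc p) (compatible_path cc q) c0 !mul1g.
    move=> /quotient_classP uv.
    exact: path_det det (congruent_paths wfE det cG relG uv p) q.
  split.
    apply: sub_finite_set (finite_image c fin) => q _.
    by have [al Nal <-] := csurj q; exists al.
  exists phi; split=> //; last exact: right_mult_faithful.
  (* The induced action uses a representative; the kernel inclusion makes the choice immaterial. *)
  have ind al s : phi al (repr (quotient_class (generated_congr R) s)) = phi al s.
    exact: (kerphi _ (quotient_repr _ s)).
  split=> //; exists (fun al q => phi al (repr q)); split=> //.
  - have [actM act1] := actphi; split=> [x s t|x].
      by rewrite actM; apply/esym/ind.
    by rewrite -[RHS]act1; exact: ind.
  exists (fun al => c (val al)).
    rewrite -setTT_bijective; split=> //.
    - move=> x y _ _ /= exy; apply/val_inj/cinj => //.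
        exact: set_mem (valP x).
      exact: set_mem (valP y).
    - move=> q _; have [al Nal <-] := csurj q.
      by exists (SigSub (mem_set Nal)).
  move=> x q; have /phiE p := erefl (phi x (repr q)).
  by rewrite (compatible_path cc p) quotient_reprK.
suff [i ri [det cG relG k]] : exists2 i, in_run r i &
    [/\ deterministic (graph_at r i), complete (graph_at r i),
      forall al, nodes (graph_at r i) al -> R `<=` path_relation (graph_at r i) al
    & kappa_at r i = Defs.diagonal (nodes (graph_at r i))].
  exists i; split=> //; first by rewrite (enumeration_start enum).
  exact: terminal_state (run_wf enum ri) det cG relG k.
have [i0 ri0 nd] := run_nondeterminism enum dr.
(* In a finite run the last state satisfies every fairness condition by itself; an infinite run
   needs the limit graph and [finM]. *)
case last: (last_index r) => [n|].
  have rE j : in_run r j = (j <= n)%N by rewrite /in_run last.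
  have rn : in_run r n by rewrite rE.
  have [|cG relG k] := settled enum rn.
    by move=> j nj; rewrite rE => jn; congr state_at; apply/eqP; rewrite eqn_leq jn.
  exists n => //; split=> //; apply: nondeterminism_diagonal k.
  by apply: nd => //; move: ri0; rewrite rE.
have rT j : in_run r j by rewrite /in_run last.
have /choice[f ev] i := (step_evolves (run_wf enum (rT i)) (run_step enum (rT i.+1))).2.
have [||||i [? ? ? ?]] := @eventually_terminal A R (state_at r) f
  (fun i => run_wf enum (rT i)) ev _ _ _ _ finM; last by exists i.
- by exists i0 => i /nd; apply.
- by move=> i al a; have [h _ _] := run_fair enum (rT i) => N ne;
    have [j []] := h _ _ N ne; exists j.
- by move=> i al u v; have [_ h _] := run_fair enum (rT i) => N Ruv;
    have [j []] := h _ _ _ N Ruv; exists j.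
- by move=> i; have [_ _ [j []]] := run_fair enum (rT i); exists j.
Qed.
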